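(* For $k\ge 0$ let $b^+_k$ denote the number of elements of length $k$ in $\mathcal{MB}^+_3$. Then $$\sum_{k\ge 0} b^+_k t^k = 1+2t+4t^2+6t^3+10t^4+16t^5+\cdots,$$ where $b^+_k=2F_{k+1}$ for all $k\ge 1$.
   Context: $(F_n)_{n\ge 0}$ is the Fibonacci sequence $F_0=0$, $F_1=1$, $F_{n+1}=F_n+F_{n-1}$. The monoid of positive $n$-braids $\mathcal{MB}_n$ is the monoid with generators $x_1,\dots,x_{n-1}$ and relations $x_ix_j=x_jx_i$ for $|i-j|\ge 2$ and $x_ix_{i+1}x_i=x_{i+1}x_ix_{i+1}$ for $1\le i\le n-2$; word length is well defined on it. The Garside braid is $\Delta_n=x_1(x_2x_1)\cdots(x_{n-1}x_{n-2}\cdots x_1)$ (so $\Delta_3=x_1x_2x_1$). $\mathcal{MB}^+_n$ is the set of positive $n$-braids that do not contain $\Delta_n$ as a subword, i.e. positive braids $\beta$ which cannot be written as $\beta=\alpha\Delta_n\gamma$ with $\alpha,\gamma\in\mathcal{MB}_n$. *)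

(* Defs.v *)
From HB Require Import structures.
From mathcomp Require Import all_boot generic_quotient finmap.
From mathcomp Require Import boolp classical_sets functions cardinality.

Set Implicit Arguments.
Unset Strict Implicit.
Unset Printing Implicit Defensive.

Local Open Scope quotient_scope.
Local Open Scope classical_set_scope.

Fixpoint fib (n : nat) : nat :=
  if n is n1.+1 then (if n1 is n2.+1 then fib n1 + fib n2 else 1) else 0.

(* Words in x_1, ..., x_(n-1); the generator x_i is encoded by the ordinal of
   value i - 1. *)
Definition braid_word (n : nat) := seq 'I_n.-1.

Inductive braid_rel (n : nat) : braid_word n -> braid_word n -> Prop :=
| braid_rel_comm (i j : 'I_n.-1) :
    (i.+2 <= j) || (j.+2 <= i) -> braid_rel [:: i; j] [:: j; i]
| braid_rel_braid (i j : 'I_n.-1) :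
    j = i.+1 :> nat -> braid_rel [:: i; j; i] [:: j; i; j].

Inductive braid_cong (n : nat) : braid_word n -> braid_word n -> Prop :=
| braid_cong_rel u v : braid_rel u v -> braid_cong u v
| braid_cong_refl u : braid_cong u u
| braid_cong_sym u v : braid_cong u v -> braid_cong v u
| braid_cong_trans u v w : braid_cong u v -> braid_cong v w -> braid_cong u w
| braid_cong_cat u u' v v' :
    braid_cong u u' -> braid_cong v v' -> braid_cong (u ++ v) (u' ++ v').

Definition braid_congb (n : nat) : rel (braid_word n) :=
  fun u v => `[< braid_cong u v >].

Lemma braid_congb_equiv n : equiv_class_of (@braid_congb n).
Proof.
split=> [u|u v|v u w].
- by apply/asboolP; apply: braid_cong_refl.
- by apply/asboolP/asboolP; apply: braid_cong_sym.
- by move=> /asboolP uv /asboolP vw; apply/asboolP; apply: braid_cong_trans vw.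
Qed.

Canonical braid_equiv n := EquivRelPack (braid_congb_equiv n).

Definition MB (n : nat) := {eq_quot (braid_equiv n)}.
HB.instance Definition _ n := Choice.on (MB n).
HB.instance Definition _ n := Quotient.on (MB n).

Definition braid_of (n : nat) (w : braid_word n) : MB n := \pi_(MB n) w.

Lemma braid_ofP n (u v : braid_word n) :
  braid_of u = braid_of v <-> braid_cong u v.
Proof.
split=> [/eqquotP/asboolP //|uv].
by apply/eqquotP; apply/asboolP.
Qed.

Lemma repr_braid_of n (w : braid_word n) : braid_cong (repr (braid_of w)) w.
Proof. by apply/braid_ofP; rewrite /braid_of reprK. Qed.

Definition MB_mul (n : nat) (a b : MB n) : MB n := braid_of (repr a ++ repr b).
Definition MB_one (n : nat) : MB n := braid_of [::].

Lemma braid_of_cat n (u v : braid_word n) :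
  MB_mul (braid_of u) (braid_of v) = braid_of (u ++ v).
Proof. by apply/braid_ofP/braid_cong_cat; apply: repr_braid_of. Qed.

Lemma braid_of_repr n (a : MB n) : braid_of (repr a) = a.
Proof. exact: reprK. Qed.

Lemma MB_mulA n : associative (@MB_mul n).
Proof.
move=> a b c; rewrite -(braid_of_repr a) -(braid_of_repr b) -(braid_of_repr c).
by rewrite !braid_of_cat catA.
Qed.

Lemma MB_mul1 n : left_id (@MB_one n) (@MB_mul n).
Proof. by move=> a; rewrite -(braid_of_repr a) braid_of_cat. Qed.

Lemma MB_mulr1 n : right_id (@MB_one n) (@MB_mul n).
Proof. by move=> a; rewrite -(braid_of_repr a) braid_of_cat cats0. Qed.

HB.instance Definition _ n :=
  isMonoid.Build (MB n) (@MB_mulA n) (@MB_mul1 n) (@MB_mulr1 n).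

Definition MB_length (n : nat) (a : MB n) : nat := size (repr a).

Lemma braid_cong_size n (u v : braid_word n) :
  braid_cong u v -> size u = size v.
Proof.
elim=> {u v} //= [u v []//|u v w _ -> _ -> //|u u' v v' _ e1 _ e2].
by rewrite !size_cat e1 e2.
Qed.

Lemma MB_length_braid_of n (w : braid_word n) : MB_length (braid_of w) = size w.
Proof. exact/braid_cong_size/repr_braid_of. Qed.

(* x_1 (x_2 x_1) ... (x_(n-1) ... x_1) *)
Definition Garside_word (n : nat) : braid_word n :=
  flatten [seq rev (take i (enum 'I_n.-1)) | i <- iota 1 n.-1].

Definition Garside (n : nat) : MB n := braid_of (Garside_word n).

Lemma Garside_word3 : Garside_word 3 = [:: ord0; ord_max; ord0].
Proof.
have e : enum 'I_2 = [:: ord0; ord_max].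
  by apply: (inj_map val_inj); rewrite val_enum_ord.
by rewrite /Garside_word [3.-1]/= e.
Qed.

Definition MBplus (n : nat) : set (MB n) :=
  [set b | ~ exists a c : MB n, b = (a * Garside n * c)%g].

Definition MBplus_len (n k : nat) : set (MB n) :=
  [set b | MBplus b /\ MB_length b = k].

Lemma finite_MBplus_len n k : finite_set (@MBplus_len n k).
Proof.
apply: (@sub_finite_set _ _
  ((fun t : k.-tuple 'I_n.-1 => braid_of (val t)) @` setT)).
  move=> b [_ /eqP bk]; exists (Tuple bk) => //=.
  exact: braid_of_repr.
exact/finite_image/finite_finset.
Qed.

Definition bplus (n k : nat) : nat := #|` fset_set (@MBplus_len n k)|.

(* Main.v *)
Require Import Defs.
From mathcomp Require Import classical_sets functions cardinality.
From mathcomp Require Import all_boot finmap.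

(** In three strands the only relation is [aba = bab], with [aba] the Garside
    word.  A word without a factor [aba] or [bab] is therefore alone in its
    congruence class, while a word with such a factor represents a braid
    divisible by the Garside braid: the words avoiding [aba] and [bab] are
    normal forms for the braids to be counted.  Reading such a word from the
    left, the next letter is free after a repeated letter and forced after a
    change of letter, whence the Fibonacci recurrence. *)

Set Implicit Arguments.
Unset Strict Implicit.
Unset Printing Implicit Defensive.

Lemma big_card2 (R : Type) (idx : R) (op : Monoid.com_law idx) (T : finType)
    (F : T -> R) (x y : T) :
  #|T| = 2 -> x != y -> \big[op/idx]_z F z = op (F x) (F y).
Proof.
move=> cardT2 xy.
have xyT : [set x; y] = setT.
  by apply/eqP; rewrite eqEcard subsetT cardsT cardT2 cards2 xy.
transitivity (\big[op/idx]_(z in [set x; y]) F z).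
  by apply: eq_bigl => z; rewrite xyT inE.
by rewrite big_setU1 ?inE // big_set1.
Qed.

Lemma card_tuple0 (T : finType) (P : pred (seq T)) :
  #|[pred t : 0.-tuple T | P t]| = P [::].
Proof.
case P0: (P [::]); last by rewrite eq_card0 // => t; rewrite tuple0 inE P0.
rewrite (eq_card (_ : _ =i predT)) ?card_tuple // => t.
by rewrite tuple0 !inE P0.
Qed.

Lemma card_tuple_cons (T : finType) (n : nat) (P : pred (seq T)) :
  #|[pred t : n.+1.-tuple T | P t]| =
  \sum_(x : T) #|[pred t : n.-tuple T | P (x :: t)]|.
Proof.
under eq_bigr do rewrite -sum1_card.
rewrite -sum1_card pair_big_dep /=.
rewrite (reindex (fun p : T * n.-tuple T => [tuple of p.1 :: p.2])) //=.
exists (fun t => (thead t, [tuple of behead t])) => [[x t] _|t _].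
  by congr pair; apply: val_inj.
by rewrite -tuple_eta.
Qed.

Section Alternations.
Variable T : finType.
Implicit Types (x y z : T) (s : seq T).

Definition has_alternation s : bool :=
  [exists x, exists y, (x != y) && infix [:: x; y; x] s].

Lemma has_alternationP s :
  reflect (exists x y, x != y /\ infix [:: x; y; x] s) (has_alternation s).
Proof.
apply: (iffP existsP) => -[x].
  by move=> /existsP[y /andP[xy xyx]]; exists x, y.
by move=> [y [xy xyx]]; exists x; apply/existsP; exists y; rewrite xy.
Qed.

Lemma has_alternation_size_le2 s : size s <= 2 -> has_alternation s = false.
Proof.
move=> s2; apply/has_alternationP => -[x [y [_ /size_infix]]].
by rewrite leqNgt ltnS s2.
Qed.

Lemma has_alternation_cons3 x y z s :
  has_alternation [:: x, y, z & s] =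
  (x != y) && (z == x) || has_alternation [:: y, z & s].
Proof.
apply/has_alternationP/orP => [[a [b [ab]]]|[/andP[xy /eqP ->]|]].
- rewrite infix_consl !prefix_cons prefix0s andbT => /orP[|aba]; last first.
    by right; apply/has_alternationP; exists a, b.
  by move=> /and3P[/eqP <- /eqP <- /eqP <-]; left; rewrite ab eqxx.
- by exists x, y; split=> //; apply: (prefix_infix [:: x; y; x]).
- move=> /has_alternationP[a [b [ab aba]]]; exists a, b; split=> //.
  exact: infix_trans aba (infix_cons _ _).
Qed.

Hypothesis cardT2 : #|T| = 2.

Lemma sum_fib_add_eq n y : \sum_z fib (n + (y == z)).+1 = fib n.+3.
Proof.
rewrite (bigD1 y) //= eqxx addn1; congr (_ + _).
under eq_bigr => z zy do rewrite eq_sym (negPf zy) addn0.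
by rewrite sum_nat_const (cardC1 y) cardT2 mul1n.
Qed.

Lemma card_alternation_free_cons2 n x y :
  #|[pred t : n.-tuple T | ~~ has_alternation [:: x, y & t]]| =
  fib (n + (x == y)).+1.
Proof.
elim: n x y => [|n IHn] x y.
  rewrite (card_tuple0 (fun s => ~~ has_alternation [:: x, y & s])).
  by rewrite has_alternation_size_le2 //; case: eqP.
rewrite (card_tuple_cons _ (fun s => ~~ has_alternation [:: x, y & s])).
have [<-|xy] := eqVneq x y.
  rewrite addn1 -(sum_fib_add_eq n x); apply: eq_bigr => z _; rewrite -IHn.
  by apply: eq_card => t; rewrite !inE has_alternation_cons3 eqxx.
rewrite (big_card2 _ _ cardT2 xy) eq_card0 => [|t]; last first.
  by rewrite !inE has_alternation_cons3 xy eqxx.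
have -> : n.+1 + false = n + (y == y) by rewrite eqxx addn0 addn1.
rewrite Monoid.mul1m -IHn; apply: eq_card => t.
by rewrite !inE has_alternation_cons3 [y == x]eq_sym (negPf xy) andbF.
Qed.

Lemma card_alternation_free_cons n x :
  #|[pred t : n.-tuple T | ~~ has_alternation (x :: t)]| = fib n.+2.
Proof.
case: n => [|n].
  rewrite (card_tuple0 (fun s => ~~ has_alternation (x :: s))).
  by rewrite has_alternation_size_le2.
rewrite (card_tuple_cons _ (fun s => ~~ has_alternation (x :: s))).
by under eq_bigr do rewrite card_alternation_free_cons2; exact: sum_fib_add_eq.
Qed.

Lemma card_alternation_free n :
  #|[pred t : n.+1.-tuple T | ~~ has_alternation t]| = 2 * fib n.+2.
Proof.
rewrite (card_tuple_cons _ (fun s => ~~ has_alternation s)).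
under eq_bigr do rewrite card_alternation_free_cons.
by rewrite sum_nat_const cardT2.
Qed.

End Alternations.

Section PositiveBraids.
Variable n : nat.
Implicit Types (u v w : braid_word n).

Definition relator_side u : Prop := exists v, braid_rel u v \/ braid_rel v u.

Definition rewritable w : Prop := exists2 u, relator_side u & infix u w.

Lemma rewritable_infix v w : infix v w -> rewritable v -> rewritable w.
Proof. by move=> vw [u ur uv]; exists u => //; apply: infix_trans vw. Qed.

Lemma braid_cong_eq_or_rewritable u v :
  braid_cong u v -> u = v \/ rewritable u /\ rewritable v.
Proof.
elim=> {u v} [u v uv|u|u v _|u v w _ IHuv _ IHvw|u u' v v' _ IHu _ IHv].
- right; split; first by exists u; [exists v; left|apply: infix_refl].
  by exists v; [exists u; right|apply: infix_refl].
- by left.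
- by case=> [->|[]]; [left|right].
- case: IHuv => [->//|[ur vr]]; right; split=> //.
  by case: IHvw => [<-|[]].
- case: IHu => [<-|[ur ur']]; last first.
    by right; split; [apply: rewritable_infix ur|apply: rewritable_infix ur'];
      apply: prefix_infix.
  case: IHv => [<-|[vr vr']]; first by left.
  by right; split; [apply: rewritable_infix vr|apply: rewritable_infix vr'];
    apply: suffix_infix.
Qed.

Lemma MBplus_braid_of w :
  MBplus (braid_of w) <->
  forall v, braid_cong w v -> ~~ infix (Garside_word n) v.
Proof.
have mul_Garside p q :
    (braid_of p * Garside n * braid_of q)%g =
    braid_of (p ++ Garside_word n ++ q).
  by rewrite -!braid_of_cat MB_mulA.
split=> [w_plus v wv|w_avoids [a [c]]].
  apply/negP => /infixP[p [q vE]]; apply: w_plus.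
  exists (braid_of p), (braid_of q); rewrite mul_Garside -vE.
  exact/braid_ofP.
rewrite -(braid_of_repr a) -(braid_of_repr c) mul_Garside => /braid_ofP.
by move=> /w_avoids; rewrite infix_infix.
Qed.

Lemma bplus_normal_form k (P : pred (braid_word n)) :
  set_bij [set w | P w]%classic (@MBplus n) (@braid_of n) ->
  bplus n k = #|[pred t : k.-tuple 'I_n.-1 | P t]|.
Proof.
move=> [P_plus P_inj P_surj].
pose nf := [pred t : k.-tuple 'I_n.-1 | P t].
have nf_inj : {in nf &, injective (fun t : k.-tuple _ => braid_of (val t))}.
  by move=> s t sP tP /P_inj st; apply/val_inj/st; apply/mem_set.
rewrite cardE -(card_in_imfset imfset_key nf_inj) /bplus.
congr #|` _|; apply/fsetP => b.
rewrite in_fset_set; last exact: finite_MBplus_len.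
apply/idP/imfsetP => [/set_mem[/P_surj[w Pw <-]] /eqP|[t Pt ->]].
  by rewrite MB_length_braid_of => wk; exists (Tuple wk).
apply/mem_set; split; first by apply: P_plus.
by rewrite MB_length_braid_of size_tuple.
Qed.

End PositiveBraids.

Lemma rewritable3_has_alternation (w : braid_word 3) :
  rewritable w -> has_alternation w.
Proof.
move=> [u [v uv] uw]; apply/has_alternationP.
suff [x [y [xy uE]]] : exists x y, x != y /\ u = [:: x; y; x].
  by exists x, y; rewrite -uE.
case: uv => -[i j ij|i j ij].
- by case: i j ij => [[|[|i]] ?] [[|[|j]] ?].
- by exists i, j; rewrite -val_eqE /= ij neq_ltn leqnn.
- by case: i j ij => [[|[|i]] ?] [[|[|j]] ?].
- by exists j, i; rewrite -val_eqE /= ij neq_ltn leqnn orbT.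
Qed.

Lemma braid3_cong_alternation_free (u v : braid_word 3) :
  ~~ has_alternation u -> braid_cong u v -> u = v.
Proof.
move=> u_free /braid_cong_eq_or_rewritable[//|[/rewritable3_has_alternation]].
by rewrite (negPf u_free).
Qed.

Lemma braid3_cong_alternation (x y : 'I_2) :
  x != y -> @braid_cong 3 [:: x; y; x] (Garside_word 3).
Proof.
have ord2 (z : 'I_2) : z = ord0 \/ z = ord_max.
  by case: z => [[|[|//]] lt_z2]; [left|right]; apply: val_inj.
rewrite Garside_word3.
case: (ord2 x) (ord2 y) => -> [] -> // _; first exact: braid_cong_refl.
exact/braid_cong_sym/braid_cong_rel/braid_rel_braid.
Qed.

Lemma MBplus3_braid_of (w : braid_word 3) :
  MBplus (braid_of w) <-> ~~ has_alternation w.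
Proof.
split=> [w_plus|w_free].
  apply/has_alternationP => -[x [y [xy /infixP[p [q wE]]]]].
  have wG : braid_cong w (p ++ Garside_word 3 ++ q).
    rewrite wE; apply/braid_cong_cat/braid_cong_cat/braid_cong_refl.
      exact: braid_cong_refl.
    exact: braid3_cong_alternation.
  by have /MBplus_braid_of/(_ _ wG) := w_plus; rewrite infix_infix.
apply/MBplus_braid_of => v /(braid3_cong_alternation_free w_free) <-.
apply: contraNN w_free; rewrite Garside_word3 => Gw.
by apply/has_alternationP; exists ord0, ord_max.
Qed.

Lemma bplus3_card k :
  bplus 3 k = #|[pred t : k.-tuple 'I_2 | ~~ has_alternation t]|.
Proof.
apply: (@bplus_normal_form 3 k (fun w => ~~ has_alternation w)); split.
- by move=> w /MBplus3_braid_of.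
- move=> u v /set_mem u_free _ /braid_ofP.
  exact: braid3_cong_alternation_free.
- move=> b; rewrite -(braid_of_repr b) => /MBplus3_braid_of b_free.
  by exists (generic_quotient.repr b).
Qed.

Theorem theorem1p3 :
  [seq bplus 3 k | k <- iota 0 6] = [:: 1; 2; 4; 6; 10; 16] /\
  (forall k : nat, 1 <= k -> bplus 3 k = 2 * fib k.+1).
Proof.
have bplus3_fib k : 0 < k -> bplus 3 k = 2 * fib k.+1.
  by case: k => // k _; rewrite bplus3_card card_alternation_free ?card_ord.
have bplus3_0 : bplus 3 0 = 1.
  rewrite bplus3_card (card_tuple0 (fun s => ~~ has_alternation s)).
  by rewrite has_alternation_size_le2.
by split=> //=; rewrite bplus3_0 !bplus3_fib.
Qed.
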